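(* Strong Vacuity is a theorem of $\mathsf{HPAL}$: for all $\varphi,\chi\in\mathcal{L}^{\div}$, the formula $$\bigwedge_{a\in Ag}\forall\neg B_a\varphi\to(\chi\leftrightarrow[\div\varphi]\chi)$$ is a theorem of $\mathsf{HPAL}$.
   Context: Language. $At$ is a countable set of atoms, $Ag$ a finite set of agents. The contraction language $\mathcal{L}^{\div}$ is given by $\varphi::=\top\mid p\mid\neg\varphi\mid\varphi\wedge\varphi\mid B_a\varphi\mid[\div\varphi]\varphi\mid\forall\varphi$ with $p\in At$, $a\in Ag$; the other Boolean connectives are the usual abbreviations. Semantics. A Kripke model is $\mathcal{M}=(W,R,V)$ with $W\neq\emptyset$, $R_a\subseteq W\times W$ an arbitrary relation for each $a\in Ag$, $V:At\to\wp(W)$; $R_a(w)=\{v:(w,v)\in R_a\}$. Atoms and Booleans are standard; $\mathcal{M},w\vDash B_a\varphi$ iff $\mathcal{M},v\vDash\varphi$ for all $v\in R_a(w)$; $\mathcal{M},w\vDash\forall\varphi$ iff $\mathcal{M},v\vDash\varphi$ for all $v\in W$; $\mathcal{M},w\vDash[\div\varphi]\psi$ iff $\mathcal{M}^{\div\varphi},w\vDash\psi$, where $\mathcal{M}^{\div\varphi}=(W,R^{\div\varphi},V)$ with $R_a^{\div\varphi}(w)=R_a(w)\cup\{v\in W:\mathcal{M},v\vDash\neg\varphi\}$ if $\mathcal{M},w\vDash B_a\varphi$, and $R_a^{\div\varphi}(w)=R_a(w)$ otherwise. Proof system $\mathsf{HPAL}$. Axioms: (CL) all classical propositional tautologies;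 ($\forall$K) $\forall(\varphi\to\psi)\to(\forall\varphi\to\forall\psi)$; ($\forall$T) $\forall\varphi\to\varphi$; ($\forall$5) $\neg\forall\varphi\to\forall\neg\forall\varphi$; ($\forall$B) $\forall\varphi\to B_a\varphi$; (BK) $B_a(\varphi\to\psi)\to(B_a\varphi\to B_a\psi)$; (A1) $[\div\varphi]p\leftrightarrow p$ for $p\in At$; (A2) $[\div\varphi]\neg\psi\leftrightarrow\neg[\div\varphi]\psi$; (A3) $[\div\varphi](\psi\wedge\chi)\leftrightarrow[\div\varphi]\psi\wedge[\div\varphi]\chi$; (A4) $[\div\varphi]\forall\psi\leftrightarrow\forall[\div\varphi]\psi$; (A5) $[\div\varphi]B_a\psi\leftrightarrow(B_a[\div\varphi]\psi\wedge(B_a\varphi\to\forall(\neg\varphi\to[\div\varphi]\psi)))$. Rules: (MP) modus ponens; (RE) from $\varphi\leftrightarrow\psi$ infer $\chi[\varphi/p]\leftrightarrow\chi[\psi/p]$ (substitution for $p$ everywhere, including inside dynamic modalities); (NEC) from $\varphi$ infer $\forall\varphi$, $B_a\varphi$, and $[\div\psi]\varphi$. $\mathsf{HPAL}$ is sound and complete: a formula is a theorem of $\mathsf{HPAL}$ iff it is true at every world of every Kripke model. *)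

(* Defs.v *)
From mathcomp Require Import all_boot.

Set Implicit Arguments.
Unset Strict Implicit.
Unset Printing Implicit Defensive.

Declare Scope form_scope.
Delimit Scope form_scope with form.

(* [Contr A B] is the formula [÷A]B. *)
Inductive form (At : countType) (Ag : finType) : Type :=
  | Top
  | Atom (p : At)
  | Neg (A : form At Ag)
  | And (A B : form At Ag)
  | Bel (a : Ag) (A : form At Ag)
  | Contr (A B : form At Ag)
  | All (A : form At Ag).

Arguments Top {At Ag}.
Arguments Atom {At Ag} p.
Bind Scope form_scope with form.

Definition Imp (At : countType) (Ag : finType) (A B : form At Ag) :=
  Neg (And A (Neg B)).
Definition Iff (At : countType) (Ag : finType) (A B : form At Ag) :=
  And (Imp A B) (Imp B A).

Notation "~' A" := (Neg A) (at level 35, right associativity) : form_scope.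
Notation "A /\' B" := (And A B) (at level 80, right associativity) : form_scope.
Notation "A ->' B" := (Imp A B) (at level 90, right associativity) : form_scope.
Notation "A <->' B" := (Iff A B) (at level 95, no associativity) : form_scope.
Notation "[÷ A ] B" := (Contr A B)
  (at level 35, A at level 200, B at level 35, right associativity,
   format "[÷ A ] B") : form_scope.

Local Open Scope form_scope.

(* The conjunction is [Top] when there are no agents. *)
Definition BigAnd (At : countType) (Ag : finType) (F : Ag -> form At Ag) :=
  \big[@And At Ag/Top]_(a : Ag) F a.

Fixpoint subst (At : countType) (Ag : finType)
    (p : At) (C A : form At Ag) : form At Ag :=
  match A with
  | Top => Top
  | Atom q => if q == p then C else Atom q
  | Neg A1 => Neg (subst p C A1)
  | And A1 A2 => And (subst p C A1) (subst p C A2)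
  | Bel a A1 => Bel a (subst p C A1)
  | Contr A1 A2 => Contr (subst p C A1) (subst p C A2)
  | All A1 => All (subst p C A1)
  end.

(* Truth-table evaluation: atoms and formulas headed by a modality are treated
   as propositional letters, so that the tautologies are exactly the instances
   in the full language of classical propositional tautologies. *)
Fixpoint truth (At : countType) (Ag : finType)
    (v : form At Ag -> bool) (A : form At Ag) : bool :=
  match A with
  | Top => true
  | Neg A1 => ~~ truth v A1
  | And A1 A2 => truth v A1 && truth v A2
  | _ => v A
  end.

Definition tautology (At : countType) (Ag : finType) (A : form At Ag) : Prop :=
  forall v : form At Ag -> bool, truth v A.

Inductive HPAL (At : countType) (Ag : finType) : form At Ag -> Prop :=
  | HPAL_CL A : tautology A -> HPAL A
  | HPAL_AllK A B : HPAL (All (A ->' B) ->' (All A ->' All B))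
  | HPAL_AllT A : HPAL (All A ->' A)
  | HPAL_All5 A : HPAL (~' All A ->' All (~' All A))
  | HPAL_AllB a A : HPAL (All A ->' Bel a A)
  | HPAL_BK a A B : HPAL (Bel a (A ->' B) ->' (Bel a A ->' Bel a B))
  | HPAL_A1 A p : HPAL ([÷ A] (Atom p) <->' Atom p)
  | HPAL_A2 A B : HPAL ([÷ A] (~' B) <->' ~' [÷ A] B)
  | HPAL_A3 A B C : HPAL ([÷ A] (B /\' C) <->' ([÷ A] B /\' [÷ A] C))
  | HPAL_A4 A B : HPAL ([÷ A] (All B) <->' All ([÷ A] B))
  | HPAL_A5 A a B :
      HPAL ([÷ A] (Bel a B) <->'
            (Bel a ([÷ A] B) /\' (Bel a A ->' All (~' A ->' [÷ A] B))))
  | HPAL_MP A B : HPAL (A ->' B) -> HPAL A -> HPAL B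
  | HPAL_RE p A B C : HPAL (A <->' B) -> HPAL (subst p A C <->' subst p B C)
  | HPAL_NecAll A : HPAL A -> HPAL (All A)
  | HPAL_NecBel a A : HPAL A -> HPAL (Bel a A)
  | HPAL_NecContr B A : HPAL A -> HPAL ([÷ B] A).

(* Main.v *)
(* There is no reduction axiom for [÷ phi][÷ psi] chi, so an induction on chi
   stalls at a nested contraction.  Every formula is therefore first shown to be
   provably equivalent to a contraction-free one; as [÷ phi] is a normal
   modality, it suffices to treat contraction-free chi.  For these, induct on
   chi under the guard G := /\_a All ~ B_a phi: G implies All G (4 follows from
   T and 5), so the induction hypothesis can be used below All and B_a, and G
   refutes the antecedent B_a phi of the extra conjunct in (A5). *)
Require Import Defs.
From mathcomp Require Import all_boot.

Set Implicit Arguments.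
Unset Strict Implicit.
Unset Printing Implicit Defensive.

Local Open Scope form_scope.

(** [taut H1 ... Hn] proves any tautological consequence of the theorems [Hi]: they are chained as
    premises by modus ponens, and the resulting implication is checked by truth tables. *)
Ltac tautology :=
  let v := fresh "v" in
  apply: HPAL_CL => v //=;
  repeat match goal with
  | |- context [truth v ?A] => case: (truth v A) => //=
  | |- context [v ?A] => case: (v A) => //=
  end.

Tactic Notation "taut" := solve [tautology].
Tactic Notation "taut" constr(H1) :=
  apply: (HPAL_MP _ H1); taut.
Tactic Notation "taut" constr(H1) constr(H2) :=
  apply: (HPAL_MP _ H1); apply: (HPAL_MP _ H2); taut.
Tactic Notation "taut" constr(H1) constr(H2) constr(H3) :=
  apply: (HPAL_MP _ H1); taut H2 H3.
Tactic Notation "taut" constr(H1) constr(H2) constr(H3) constr(H4) :=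
  apply: (HPAL_MP _ H1); taut H2 H3 H4.

Section StrongVacuity.

Variables (At : countType) (Ag : finType).
Implicit Types (a : Ag) (A B C F G phi chi : form At Ag).

Lemma All_mono A B : HPAL (A ->' B) -> HPAL (All A ->' All B).
Proof. by move/HPAL_NecAll; apply/HPAL_MP/HPAL_AllK. Qed.

Lemma Bel_mono a A B : HPAL (A ->' B) -> HPAL (Bel a A ->' Bel a B).
Proof. by move/(HPAL_NecBel a); apply/HPAL_MP/HPAL_BK. Qed.

(** Axiom K for contraction. Since [->'] unfolds to [~'] and [/\'], it follows from (A2) and (A3)
    alone. *)
Lemma Contr_Imp F A B :
  HPAL ([÷ F] (A ->' B) ->' ([÷ F] A ->' [÷ F] B)).
Proof.
taut (HPAL_A2 F (A /\' ~' B)) (HPAL_A3 F A (~' B)) (HPAL_A2 F B).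
Qed.

Lemma Contr_mono F A B : HPAL (A ->' B) -> HPAL ([÷ F] A ->' [÷ F] B).
Proof. by move/(HPAL_NecContr F); apply/HPAL_MP/Contr_Imp. Qed.

Lemma Iff_intro A B : HPAL (A ->' B) -> HPAL (B ->' A) -> HPAL (A <->' B).
Proof. by move=> AB BA; taut AB BA. Qed.

Lemma Iff_fwd A B : HPAL (A <->' B) -> HPAL (A ->' B).
Proof. by move=> AB; taut AB. Qed.

Lemma Iff_bwd A B : HPAL (A <->' B) -> HPAL (B ->' A).
Proof. by move=> AB; taut AB. Qed.

Lemma Iff_trans A B C : HPAL (A <->' B) -> HPAL (B <->' C) -> HPAL (A <->' C).
Proof. by move=> AB BC; taut AB BC. Qed.

Lemma All_Iff A B : HPAL (A <->' B) -> HPAL (All A <->' All B).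
Proof.
move=> AB; apply: Iff_intro; apply: All_mono; [exact: Iff_fwd|exact: Iff_bwd].
Qed.

Lemma Bel_Iff a A B : HPAL (A <->' B) -> HPAL (Bel a A <->' Bel a B).
Proof.
move=> AB; apply: Iff_intro; apply: Bel_mono; [exact: Iff_fwd|exact: Iff_bwd].
Qed.

Lemma Contr_Iff F A B : HPAL (A <->' B) -> HPAL ([÷ F] A <->' [÷ F] B).
Proof.
move=> AB; apply: Iff_intro; apply: Contr_mono; [exact: Iff_fwd|exact: Iff_bwd].
Qed.

(** Carries an implication proved under a guard [G] below [All], at the cost of boxing the guard. *)
Lemma All_mono2 G A B :
  HPAL (G ->' (A ->' B)) -> HPAL (All G ->' (All A ->' All B)).
Proof. by move/All_mono=> GAB; taut GAB (HPAL_AllK A B). Qed.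

Lemma Bel_mono2 a G A B :
  HPAL (G ->' (A ->' B)) -> HPAL (Bel a G ->' (Bel a A ->' Bel a B)).
Proof. by move/(Bel_mono a)=> GAB; taut GAB (HPAL_BK a A B). Qed.

Lemma All_4 A : HPAL (All A ->' All (All A)).
Proof.
(* The usual S5 argument: T gives that [All A] is possible, 5 makes this possibility necessary, and
   below the outer [All] the contrapositive of 5 turns possibly [All A] back into [All A]. *)
have dia : HPAL (All A ->' ~' All (~' All A)) by taut (HPAL_AllT (~' All A)).
have box : HPAL (All (~' All (~' All A)) ->' All (All A)).
  by apply: All_mono; taut (HPAL_All5 A).
by taut dia (HPAL_All5 (~' All A)) box.
Qed.

Lemma BigAnd_elim (F : Ag -> form At Ag) a : HPAL (BigAnd F ->' F a).
Proof.
rewrite /BigAnd; elim: (index_enum Ag) (mem_index_enum a) => // b s IHs.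
rewrite inE big_cons => /orP[/eqP-> | /IHs IH]; first by taut.
by taut IH.
Qed.

Lemma BigAnd_All_4 (F : Ag -> form At Ag) :
  HPAL (BigAnd (fun a => All (F a)) ->' All (BigAnd (fun a => All (F a)))).
Proof.
rewrite /BigAnd; elim: (index_enum Ag) => [|b s IHs].
  have top : HPAL (@Top At Ag) by taut.
  by rewrite big_nil; taut (HPAL_NecAll top).
rewrite big_cons; set G := \big[_/_]_(a <- s) _ in IHs *.
have pair : HPAL (All (All (F b)) ->' (All G ->' All (All (F b) /\' G))).
  by apply: All_mono2; taut.
by taut IHs (All_4 (F b)) pair.
Qed.

Fixpoint static A : bool :=
  match A with
  | Top | Atom _ => true
  | Neg A1 | Bel _ A1 | All A1 => static A1
  | And A1 A2 => static A1 && static A2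
  | Contr _ _ => false
  end.

(* The contracted formula A is replaced by a static A' in the same induction:
   rule (RE) would need an atom, and At may be empty. *)
Lemma Contr_static A A' B : static A' -> HPAL (A <->' A') -> static B ->
  exists2 C, static C & HPAL ([÷ A] B <->' C).
Proof.
move=> sA' AA'; elim: B => //=.
(* No reduction axiom covers [Top]; necessitation for contraction replaces it. *)
- have top : HPAL (@Top At Ag) by taut.
  by exists Top; last taut (HPAL_NecContr A top).
- by move=> p _; exists (Atom p); last exact: HPAL_A1.
- move=> B IHB /IHB[C sC BC]; exists (~' C) => //.
  by taut (HPAL_A2 A B) BC.
- move=> B1 IH1 B2 IH2 /andP[/IH1[C1 sC1 BC1] /IH2[C2 sC2 BC2]].
  exists (C1 /\' C2); first by rewrite /= sC1.
  by taut (HPAL_A3 A B1 B2) BC1 BC2.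
- move=> a B IHB /IHB[C sC BC].
  (* The right-hand side of (A5), with [A] and [[÷ A] B] replaced by their static equivalents. *)
  exists (Bel a C /\' (Bel a A' ->' All (~' A' ->' C))).
    by rewrite /= sC sA'.
  have E : HPAL ((~' A ->' [÷ A] B) <->' (~' A' ->' C)) by taut AA' BC.
  by taut (HPAL_A5 A a B) (Bel_Iff a BC) (Bel_Iff a AA') (All_Iff E).
- move=> B IHB /IHB[C sC BC]; exists (All C) => //.
  exact: Iff_trans (HPAL_A4 A B) (All_Iff BC).
Qed.

Lemma static_equiv A : exists2 A', static A' & HPAL (A <->' A').
Proof.
elim: A => [|p|A [A' sA AA]|A [A' sA AA] B [B' sB BB]|a A [A' sA AA]
           |A [A' sA AA] B [B' sB BB]|A [A' sA AA]].
- by exists Top; last taut.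
- by exists (Atom p); last taut.
- by exists (~' A'); last taut AA.
- by exists (A' /\' B'); [rewrite /= sA|taut AA BB].
- by exists (Bel a A'); last exact: Bel_Iff.
(* Inner contractions are removed first, so that only the outermost one is left to reduce. *)
- have [C sC BC] := Contr_static sA AA sB.
  by exists C; last exact: Iff_trans (Contr_Iff A BB) BC.
- by exists (All A'); last exact: All_Iff.
Qed.

(** The guard stays abstract: the induction sees only that it implies its own necessity and refutes
    every [Bel a phi]. *)
Lemma static_vacuity G phi chi :
    HPAL (G ->' All G) -> (forall a, HPAL (G ->' ~' Bel a phi)) ->
  static chi -> HPAL (G ->' (chi <->' [÷ phi] chi)).
Proof.
move=> GG Gphi; elim: chi => //=.
- move=> _; have top : HPAL (@Top At Ag) by taut.
  by taut (HPAL_NecContr phi top).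
- by move=> p _; taut (HPAL_A1 phi p).
- by move=> A IHA /IHA IH; taut IH (HPAL_A2 phi A).
- move=> A IHA B IHB /andP[/IHA IH1 /IHB IH2].
  by taut IH1 IH2 (HPAL_A3 phi A B).
- move=> a A IHA /IHA IH.
  have IHl : HPAL (G ->' (A ->' [÷ phi] A)) by taut IH.
  have IHr : HPAL (G ->' ([÷ phi] A ->' A)) by taut IH.
  have GB : HPAL (G ->' Bel a G) by taut GG (HPAL_AllB a G).
  have E : HPAL (G ->' (Bel a A <->' Bel a ([÷ phi] A))).
    by taut GB (Bel_mono2 a IHl) (Bel_mono2 a IHr).
  by taut E (Gphi a) (HPAL_A5 phi a A).
- move=> A IHA /IHA IH.
  have IHl : HPAL (G ->' (A ->' [÷ phi] A)) by taut IH.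
  have IHr : HPAL (G ->' ([÷ phi] A ->' A)) by taut IH.
  by taut GG (All_mono2 IHl) (All_mono2 IHr) (HPAL_A4 phi A).
Qed.

End StrongVacuity.

Theorem proposition6p4 (At : countType) (Ag : finType) (phi chi : form At Ag) :
  HPAL (BigAnd (fun a : Ag => All (~' Bel a phi)) ->' (chi <->' [÷ phi] chi))%form.
Proof.
have GG := BigAnd_All_4 (fun a : Ag => ~' Bel a phi).
have Gphi := BigAnd_elim (fun a : Ag => All (~' Bel a phi)).
set G := BigAnd _ in GG Gphi *.
have [chi' schi' E] := static_equiv chi.
have vac : HPAL (G ->' (chi' <->' [÷ phi] chi')).
  apply: static_vacuity => // a.
  by taut (Gphi a) (HPAL_AllT (~' Bel a phi)).
(* [E] exchanges [chi] and [chi'] outside the contraction, [Contr_Iff] inside it. *)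
by taut E vac (Contr_Iff phi E).
Qed.
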